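(* (1) Every concept class $\mathcal{C}\subseteq\{0,1\}^n$ satisfies $\mathtt{vc}^\star(\mathcal{C})\leq\mathtt{r}(\mathcal{C})$. (2) For general concept classes, $\mathtt{r}(\mathcal{C})$ is not upper-bounded in terms of $\mathtt{vc}(\mathcal{C})$ or $\mathtt{vc}^\star(\mathcal{C})$: there is no function $F$ such that $\mathtt{r}(\mathcal{C})\leq F(\mathtt{vc}(\mathcal{C}),\mathtt{vc}^\star(\mathcal{C}))$ for all concept classes $\mathcal{C}$. (3) If $\mathcal{C}$ is extremal, then $\mathtt{r}(\mathcal{C})\leq 2^{\mathtt{vc}^\star(\mathcal{C})+2}-1$, and this bound is tight up to a multiplicative factor: there is an absolute constant $\alpha>0$ and extremal classes $\mathcal{C}$ with arbitrarily large $\mathtt{vc}^\star(\mathcal{C})$ such that $\mathtt{r}(\mathcal{C})\geq \alpha\, 2^{\mathtt{vc}^\star(\mathcal{C})+2}$.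
   Context: A concept class is a subset $\mathcal{C}\subseteq\{0,1\}^n$; each $c\in\mathcal{C}$ is a function $c:[n]\to\{0,1\}$. $\mathcal{C}$ shatters $A\subseteq[n]$ if every pattern in $\{0,1\}^A$ is realized by restricting some $c\in\mathcal{C}$ to $A$; $\mathtt{vc}(\mathcal{C})$ is the largest size of a shattered set. $\mathcal{C}$ is extremal if $|\mathcal{C}|$ equals the number of subsets of $[n]$ shattered by $\mathcal{C}$. The dual VC dimension $\mathtt{vc}^\star(\mathcal{C})$ is the largest $k$ such that some $c_1,\dots,c_k\in\mathcal{C}$ satisfy: for every $S\subseteq[k]$ there is $x\in[n]$ with $c_i(x)=1$ iff $i\in S$. Convexity space of $\mathcal{C}$: half-spaces are $\mathcal{C}_{x,y}=\{c\in\mathcal{C}:c(x)=y\}$ ($x\in[n]$, $y\in\{0,1\}$), convex sets are arbitrary intersections of half-spaces, and $\mathtt{conv}(P)$ is the intersection of all convex sets containing $P\subseteq\mathcal{C}$. Elements $c_1,\dots,c_k$ are Radon-independent if $\mathtt{conv}(\{c_i:i\in I\})\cap\mathtt{conv}(\{c_j:j\in J\})=\emptyset$ for every partition of $[k]$ into two nonempty parts $I,J$. $\mathtt{r}(\mathcal{C})$ is the largest size of a Radon-independent set. *)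

(* Defs.v *)
From mathcomp Require Import all_boot all_order all_algebra.
From mathcomp Require Import reals.

Set Implicit Arguments.
Unset Strict Implicit.
Unset Printing Implicit Defensive.

Definition concept (n : nat) := {ffun 'I_n -> bool}.

Section ConceptClass.

Variables (n : nat) (C : {set concept n}).

(* The values of p outside A are irrelevant: p stands for a pattern on A. *)
Definition shatters (A : {set 'I_n}) : bool :=
  [forall p : {ffun 'I_n -> bool},
    [exists c in C, [forall x in A, c x == p x]]].

Definition vc : nat := \max_(A : {set 'I_n} | shatters A) #|A|.

Definition extremal : bool := #|C| == #|[set A : {set 'I_n} | shatters A]|.

Definition dual_shattered (k : nat) : bool :=
  [exists c : {ffun 'I_k -> concept n},
    [forall i, c i \in C] &&
    [forall S : {set 'I_k}, [exists x : 'I_n,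
      [forall i, c i x == (i \in S)]]]].

(* The bound on k in the definition of dual_vc below loses nothing. *)
Lemma dual_shattered_leq (k : nat) : dual_shattered k -> k <= #|C|.
Proof.
case/existsP=> c /andP[/forallP cC /forallP sh].
have injc : injective c.
  move=> i j eq_ij; have /existsP[x /forallP cx] := sh [set i].
  have := eqP (cx i); rewrite eq_ij (eqP (cx j)) !inE eqxx.
  by move/eqP.
rewrite -[k]card_ord -cardsT -(card_imset _ injc) subset_leq_card //.
by apply/subsetP=> _ /imsetP[i _ ->].
Qed.

Definition dual_vc : nat := \max_(k < #|C|.+1 | dual_shattered k) k.

Definition halfspace (x : 'I_n) (y : bool) : {set concept n} :=
  [set c in C | c x == y].

Definition halfspaces : {set {set concept n}} :=
  [set halfspace xy.1 xy.2 | xy : 'I_n * bool].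

(* The ambient space is C, so the empty intersection of half-spaces is C. *)
Definition convex (K : {set concept n}) : bool :=
  [exists H : {set {set concept n}},
    (H \subset halfspaces) && (K == C :&: \bigcap_(h in H) h)].

Definition conv (P : {set concept n}) : {set concept n} :=
  \bigcap_(K : {set concept n} | convex K && (P \subset K)) K.

Definition radon_independent (P : {set concept n}) : bool :=
  [forall I : {set concept n}, forall J : {set concept n},
    [&& I != set0, J != set0, I :&: J == set0 & I :|: J == P] ==>
    (conv I :&: conv J == set0)].

Definition radon : nat :=
  \max_(P : {set concept n} | (P \subset C) && radon_independent P) #|P|.

End ConceptClass.

(* Main.v *)
Require Import Defs.
From mathcomp Require Import all_boot all_order all_algebra.
From mathcomp Require Import reals.
From mathcomp Require Import zify.

(** The first inequality holds because a dual-shattered family is separated by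
    half-spaces. The class of all one-point indicators has primal and dual VC
    dimension at most one, but its [n] elements are Radon-independent: the only
    vector in two disjoint cube hulls is [0]. The same points in the cube minus
    [0], which is extremal, give tightness, since [2 ^ dual_vc <= n] always.

    The upper bound combines [vc < 2 ^ (dual_vc + 1)] with
    [radon <= 2 vc + 1] for extremal classes, a van Kampen-Flores type theorem.
    The cubes contained in an extremal class form a complex of dimension
    [d = vc] whose convex pieces are F_2-acyclic (split along a coordinate and
    glue along the reduction, as in Mayer-Vietoris). Given [2d + 2]
    Radon-independent points, acyclicity yields a chain map from the simplex on
    these points carried by the convex hulls, hence an equivariant chain map
    from the deleted join of the simplex, a sphere of dimension [2d + 1], to the
    join of the complex with itself minus the diagonal. The image of the
    fundamental cycle is a top-dimensional cycle of an acyclic complex, so it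
    vanishes, and descending through the equatorial hemispheres contradicts the
    freeness of the swap. *)

Set Implicit Arguments.
Unset Strict Implicit.
Unset Printing Implicit Defensive.

Import GRing.Theory Num.Theory.

(** * Elementary comparisons of the VC, dual VC and Radon numbers *)

Lemma leq_bigmax_exists (I : finType) (P : pred I) (F : I -> nat) m :
  0 < m -> m <= \max_(i | P i) F i -> exists2 i, P i & m <= F i.
Proof.
move=> m_gt0 le_m; case: (pickP [pred i | P i && (m <= F i)]) => [i /andP[Pi mi]|no].
  by exists i.
suff : \max_(i | P i) F i <= m.-1 by lia.
apply/bigmax_leqP => i Pi; have /= := no i; rewrite Pi /=; lia.
Qed.

Section Class.
Variables (n : nat) (C : {set concept n}).

Lemma shattersP (A : {set 'I_n}) :
  reflect (forall p : concept n, exists2 c, c \in C & {in A, c =1 p}) (shatters C A).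
Proof.
apply: (iffP forallP) => sh p; have := sh p.
  by case/exists_inP=> c cC /forall_inP cp; exists c => // x /cp/eqP.
by case=> c cC cp; apply/exists_inP; exists c => //; apply/forall_inP => x /cp ->.
Qed.

Lemma dual_shatteredP k :
  reflect (exists2 c : 'I_k -> concept n, (forall i, c i \in C) &
             forall S : {set 'I_k}, exists x, forall i, c i x = (i \in S))
          (dual_shattered C k).
Proof.
apply: (iffP existsP) => [[c /andP[/forallP cC /forallP sh]] | [c cC sh]].
  exists c => // S; have /existsP[x /forallP cx] := sh S.
  by exists x => i; exact/eqP.
exists [ffun i => c i]; apply/andP; split.
  by apply/forallP=> i; rewrite ffunE.
apply/forallP=> S.
have [x cx] := sh S; apply/existsP; exists x; apply/forallP => i.
by rewrite ffunE cx.
Qed.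

Lemma dual_shattered_dual_vc k : dual_shattered C k -> k <= dual_vc C.
Proof.
move=> dk; have ltk : k < #|C|.+1 by rewrite ltnS dual_shattered_leq.
exact: (@leq_bigmax_cond _ _ (fun i : 'I_#|C|.+1 => val i) (Ordinal ltk)).
Qed.

(** Name [2 ^ k] points of [A] by the subsets of ['I_k]; the pattern of the [i]-th concept then
    reads off membership of [i]. *)
Lemma shatters_dual_shattered (A : {set 'I_n}) k :
  shatters C A -> 2 ^ k <= #|A| -> dual_shattered C k.
Proof.
move=> /shattersP shA leA; apply/dual_shatteredP.
pose sets := enum {: {set 'I_k}}.
pose p (i : 'I_k) : concept n := [ffun x => i \in nth set0 sets (index x (enum A))].
have /fin_all_exists2[c cC cp] : forall i, exists2 c, c \in C & {in A, c =1 p i}.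
  by move=> i; apply: shA.
have size_sets : size sets = 2 ^ k.
  by rewrite /sets -cardE -cardsT -powersetT card_powerset cardsT card_ord.
exists c => // S.
have lt_S : index S sets < #|A|.
  by apply: leq_trans leA; rewrite -size_sets index_mem mem_enum.
have [x0 _] : exists x0, x0 \in A by apply/card_gt0P; case: (#|A|) lt_S.
have inA : nth x0 (enum A) (index S sets) \in A.
  by rewrite -mem_enum mem_nth // -cardE.
exists (nth x0 (enum A) (index S sets)) => i.
rewrite (cp i _ inA) ffunE index_uniq ?enum_uniq -?cardE //.
by rewrite nth_index // mem_enum.
Qed.

Lemma vc_lt_dual_vc : vc C < 2 ^ (dual_vc C).+1.
Proof.
rewrite ltnNge; apply/negP => /leq_bigmax_exists[|A shA leA].
  by rewrite expn_gt0.
by have := dual_shattered_dual_vc (shatters_dual_shattered shA leA); rewrite ltnn.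
Qed.

Lemma exp_dual_shattered k : dual_shattered C k -> 2 ^ k <= n.
Proof.
case/dual_shatteredP=> c _ /fin_all_exists[f cf].
have injf : injective f.
  by move=> S T eqST; apply/setP=> i; rewrite -!cf eqST.
by have := leq_card f injf; rewrite card_ord -cardsT -powersetT card_powerset cardsT card_ord.
Qed.

Lemma exp_dual_vc : 0 < n -> 2 ^ dual_vc C <= n.
Proof.
move=> n_gt0; apply: leq_trans (trunc_logP (isT : 1 < 2) n_gt0).
rewrite leq_exp2l //; apply/bigmax_leqP => k /exp_dual_shattered.
exact: trunc_log_max.
Qed.

Lemma convex_full : convex C C.
Proof.
by apply/existsP; exists set0; rewrite sub0set big_set0 setIT eqxx.
Qed.

Lemma convex_halfspace x y : convex C (halfspace C x y).
Proof.
apply/existsP; exists [set halfspace C x y]; rewrite sub1set big_set1.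
apply/andP; split; first by apply/imsetP; exists (x, y).
by apply/eqP/setP=> c; rewrite !inE andbA andbb.
Qed.

Lemma conv_sub (P K : {set concept n}) : convex C K -> P \subset K -> conv C P \subset K.
Proof. by move=> cK sPK; apply: (bigcap_inf K); rewrite cK. Qed.

Lemma conv_halfspace (P : {set concept n}) c x y :
  P \subset C -> (forall p, p \in P -> p x = y) -> c \in conv C P -> c x = y.
Proof.
move=> sPC Px; have /subsetP cP : conv C P \subset halfspace C x y.
  apply: conv_sub (convex_halfspace x y) _; apply/subsetP=> p pP.
  by rewrite inE (subsetP sPC) // Px /=.
by move/cP; rewrite inE => /andP[_ /eqP].
Qed.

Lemma card_radon (P : {set concept n}) :
  P \subset C -> radon_independent C P -> #|P| <= radon C.
Proof.
move=> sPC indP; by rewrite /radon (bigmax_sup P) ?sPC.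
Qed.

Lemma radon_independentP (P : {set concept n}) :
  (forall I J : {set concept n}, I \subset P -> J = P :\: I -> conv C I :&: conv C J = set0) ->
  radon_independent C P.
Proof.
move=> indP; apply/forallP=> I; apply/forallP=> J.
apply/implyP=> /and4P[_ _ /eqP IJ0 /eqP IJP]; apply/eqP/indP.
  by rewrite -IJP subsetUl.
by rewrite -IJP setDUl setDv set0U setDE; apply/esym/setIidPl;
  rewrite -disjoints_subset -setI_eq0 setIC IJ0.
Qed.

(** For a splitting of the family into [I] and [J], the coordinate realizing [I] puts the two hulls
    into complementary half-spaces. *)
Lemma dual_vc_radon : dual_vc C <= radon C.
Proof.
apply/bigmax_leqP => k /dual_shatteredP[c cC sh].
have injc : injective c.
  move=> i j eq_ij; have [x cx] := sh [set i].
  by apply/esym/set1P; rewrite -cx -eq_ij cx set11.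
have sPC : c @: [set: 'I_k] \subset C.
  by apply/subsetP=> _ /imsetP[i _ ->].
rewrite -[X in X <= _](_ : #|c @: [set: 'I_k]| = k); last first.
  by rewrite card_imset // cardsT card_ord.
apply: card_radon => //; apply: radon_independentP => I J sIP defJ.
have [x cx] := sh (c @^-1: I).
apply/setP=> e; rewrite !inE; apply/andP=> -[eI eJ].
have e1 : e x = true.
  apply: conv_halfspace eI; first exact: subset_trans sPC.
  by move=> p pI; have /imsetP[i _ pE] := subsetP sIP _ pI; rewrite pE cx inE -pE.
have : e x = false; last by rewrite e1.
apply: conv_halfspace eJ; first by rewrite defJ (subset_trans _ sPC) ?subsetDl.
move=> p; rewrite defJ inE => /andP[pI /imsetP[i _ pE]].
by rewrite pE cx inE -pE (negbTE pI).
Qed.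

Definition indicator (i : 'I_n) : concept n := [ffun x => x == i].

Lemma indicator_inj : injective indicator.
Proof.
by move=> i j /ffunP/(_ i); rewrite !ffunE eqxx => /esym/eqP.
Qed.

(** At each coordinate [x] one of the two parts omits [indicator x], so its hull is constantly
    [false] there. A common point would be the zero vector, which [C] omits. *)
Lemma leq_radon_indicator :
  [ffun => false] \notin C -> (forall i, indicator i \in C) -> n <= radon C.
Proof.
move=> C0 C1.
have sPC : indicator @: [set: 'I_n] \subset C by apply/subsetP=> _ /imsetP[i _ ->].
rewrite -[X in X <= _](_ : #|indicator @: [set: 'I_n]| = n); last first.
  by rewrite card_imset ?cardsT ?card_ord //; exact: indicator_inj.
apply: card_radon => //; apply: radon_independentP => I J sIP defJ.
have sIC := subset_trans sIP sPC.
have sJP : J \subset indicator @: [set: 'I_n] by rewrite defJ subsetDl.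
have avoid (K : {set concept n}) x e :
    K \subset indicator @: [set: 'I_n] -> indicator x \notin K ->
    e \in conv C K -> e x = false.
  move=> sKP xK; apply: conv_halfspace; first exact: subset_trans sPC.
  move=> p pK; have /imsetP[i _ pE] := subsetP sKP _ pK.
  by rewrite pE ffunE; apply: contraNF xK => /eqP->; rewrite -pE.
apply/setP=> e; rewrite !inE; apply/andP=> -[eI eJ].
case/negP: C0; suff <- : e = [ffun => false].
  by apply: (subsetP (conv_sub convex_full sIC)).
apply/ffunP=> x; rewrite ffunE.
have [xI|xI] := boolP (indicator x \in I); last exact: avoid eI.
by apply: avoid eJ => //; rewrite defJ inE xI.
Qed.

End Class.

(** * The class of indicators and the punctured cube *)

Section Indicators.
Variable n : nat.

Definition indicators : {set concept n} := [set indicator i | i : 'I_n].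

Lemma vc_indicators : vc indicators <= 1.
Proof.
apply/bigmax_leqP => A /shattersP sh; rewrite leqNgt; apply/negP.
case/card_gt1P=> x [y [xA yA neq]].
have [_ /imsetP[i _ ->] ci] := sh [ffun => true].
have := ci x xA; have := ci y yA; rewrite !ffunE => /eqP yi /eqP xi.
by rewrite xi yi eqxx in neq.
Qed.

Lemma dual_vc_indicators : dual_vc indicators <= 1.
Proof.
apply/bigmax_leqP => -[[|[|k]] //= _] /dual_shatteredP[c cC sh].
have [x cx] := sh setT; have [y cy] := sh [set ord0].
have := cx ord0; have := cx ord_max; have := cy ord0; have := cy ord_max.
have /imsetP[i _ ->] := cC ord0; have /imsetP[j _ ->] := cC ord_max.
by rewrite !ffunE !inE eqxx => yj /eqP yi /eqP xj /eqP xi; move: yj; rewrite yi -xi xj eqxx.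
Qed.

Lemma leq_radon_indicators : n <= radon indicators.
Proof.
apply: leq_radon_indicator => [|i]; last exact: imset_f.
by apply/imsetP=> -[i _ /ffunP/(_ i)]; rewrite !ffunE eqxx.
Qed.

Definition nonzero : {set concept n} := [set~ [ffun => false]].

Lemma leq_radon_nonzero : 0 < n -> n <= radon nonzero.
Proof.
move=> n_gt0; apply: leq_radon_indicator => [|i]; rewrite !inE ?eqxx //.
by apply/eqP=> /ffunP/(_ i); rewrite !ffunE eqxx.
Qed.

(** Only the zero pattern on all coordinates is lost; a coordinate outside [A] can absorb a
    [true]. *)
Lemma shatters_nonzero (A : {set 'I_n}) : shatters nonzero A = (A != setT).
Proof.
apply/shattersP/idP => [sh|].
  apply/eqP => AT; have [c] := sh [ffun => false].
  rewrite !inE => /eqP c0 cE; apply: c0; apply/ffunP=> x.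
  by rewrite cE // AT inE.
rewrite -subTset => /subsetPn[x _ xA] p.
exists [ffun y => if y \in A then p y else true]; last by move=> y yA; rewrite ffunE yA.
by rewrite !inE; apply/eqP=> /ffunP/(_ x); rewrite !ffunE (negbTE xA).
Qed.

Lemma extremal_nonzero : extremal nonzero.
Proof.
rewrite /extremal (_ : [set A | _] = [set~ setT]).
  by rewrite !cardsC1 card_ffun card_bool -[#|{set _}|]cardsT -powersetT card_powerset cardsT.
by apply/setP=> A; rewrite !inE shatters_nonzero.
Qed.

End Indicators.

Lemma leq_dual_vc_nonzero m : m <= dual_vc (nonzero (2 ^ m.+1)).
Proof.
have n_gt0 : 0 < 2 ^ m.+1 by rewrite expn_gt0.
apply: dual_shattered_dual_vc.
apply: (@shatters_dual_shattered _ _ [set~ (Ordinal n_gt0)]).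
  by rewrite shatters_nonzero; apply/eqP=> /setP/(_ (Ordinal n_gt0)); rewrite !inE eqxx.
by rewrite cardsC1 card_ord expnS; have := expn_gt0 2 m; lia.
Qed.

(** * Extremal classes: counting shattered sets, cubes, lopsidedness *)

Section Lopsided.
Variable n : nat.
Implicit Types (C : {set concept n}) (A : {set 'I_n}) (H : seq ('I_n * bool)).

Definition shattered C : {set {set 'I_n}} := [set A | shatters C A].

Lemma card_halfspaces C x : #|halfspace C x false| + #|halfspace C x true| = #|C|.
Proof.
rewrite -(cardsID [set c : concept n | c x == false] C); congr (_ + _).
  by apply: eq_card => c; rewrite !inE.
by apply: eq_card => c; rewrite !inE andbC eqbF_neg negbK eqb_id.
Qed.

Lemma shatters_sub C1 C2 A : C1 \subset C2 -> shatters C1 A -> shatters C2 A.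
Proof.
move=> /subsetP sC /shattersP sh; apply/shattersP=> p.
by have [c /sC cC cp] := sh p; exists c.
Qed.

Lemma halfspace_sub C x b : halfspace C x b \subset C.
Proof. by apply/subsetP=> c; rewrite inE => /andP[]. Qed.

Lemma shatters_halfspace_notin C x b A : shatters (halfspace C x b) A -> x \notin A.
Proof.
move=> /shattersP/(_ [ffun => ~~ b])[c]; rewrite inE => /andP[_ /eqP cx] cA.
by apply/negP=> /cA; rewrite ffunE cx; case: (b).
Qed.

Lemma shattered_halfspacesU C x :
  shattered (halfspace C x false) :|: shattered (halfspace C x true)
    \subset shattered C :\: [set A : {set 'I_n} | x \in A].
Proof.
apply/subsetP=> A; rewrite !inE.
case/orP=> sh; rewrite (shatters_halfspace_notin sh);
  exact: shatters_sub (halfspace_sub _ _ _) sh.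
Qed.

(** A set shattered by both halves stays shattered after adding [x]: the value wanted at [x] selects
    the half. *)
Lemma card_shattered_halfspacesI C x :
  #|shattered (halfspace C x false) :&: shattered (halfspace C x true)|
    <= #|shattered C :&: [set A : {set 'I_n} | x \in A]|.
Proof.
have injU : {in shattered (halfspace C x false) :&: shattered (halfspace C x true) &,
    injective (fun A : {set 'I_n} => x |: A)}.
  move=> A1 A2 /setIP[A1sh _] /setIP[A2sh _] eqA.
  have xA1 : x \notin A1 by move: A1sh; rewrite inE; apply: shatters_halfspace_notin.
  have xA2 : x \notin A2 by move: A2sh; rewrite inE; apply: shatters_halfspace_notin.
  by rewrite -(setU1K xA1) eqA setU1K.
rewrite -(card_in_imset injU); apply: subset_leq_card; apply/subsetP=> _ /imsetP[A + ->].
rewrite !inE => /andP[sh0 sh1]; rewrite eqxx andbT.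
apply/shattersP=> p.
have /shattersP/(_ p)[c] : shatters (halfspace C x (p x)) A by case: (p x).
rewrite inE => /andP[cC /eqP cx] cA; exists c => // y.
by rewrite !inE => /predU1P[-> // | /cA].
Qed.

Lemma leq_card_shattered_halfspaces C x :
  #|shattered (halfspace C x false)| + #|shattered (halfspace C x true)|
    <= #|shattered C|.
Proof.
rewrite -cardsUI -(cardsID [set A : {set 'I_n} | x \in A] (shattered C)) addnC.
by rewrite leq_add ?card_shattered_halfspacesI ?subset_leq_card ?shattered_halfspacesU.
Qed.

Lemma neq_halfspaces C c1 c2 : c1 \in C -> c2 \in C -> c1 != c2 ->
  exists x, forall b, halfspace C x b != set0.
Proof.
move=> c1C c2C neq; have /existsP[x cx] : [exists x, c1 x != c2 x].
  apply: contraNT neq => /existsPn eqc; apply/eqP/ffunP=> x; apply/eqP.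
  exact: negbNE (eqc x).
exists x => b; apply/set0Pn.
have [c1b|c1b] := eqVneq (c1 x) b; first by exists c1; rewrite inE c1C c1b eqxx.
exists c2; rewrite inE c2C; move: cx c1b.
by case: (c1 x); case: (c2 x); case: b.
Qed.

Lemma card_halfspace_lt C x b :
  (forall b, halfspace C x b != set0) -> #|halfspace C x b| < #|C|.
Proof.
move=> nh; have := card_halfspaces C x; have := nh (~~ b); rewrite -card_gt0.
by case: b => /=; lia.
Qed.

(** Pajor's inequality: under halving, cardinalities add up exactly while the counts of shattered
    sets are superadditive. *)
Lemma card_leq_shattered C : #|C| <= #|shattered C|.
Proof.
have [k] := ubnP #|C|; elim: k C => // k IHk C ltC.
have [le1|] := leqP #|C| 1.
  have [->|/set0Pn[c cC]] := eqVneq C set0; first by rewrite cards0.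
  apply: leq_trans le1 _; rewrite card_gt0; apply/set0Pn; exists set0.
  by rewrite inE; apply/shattersP=> p; exists c => // x; rewrite inE.
case/card_gt1P=> c1 [c2 [c1C c2C neq]].
have [x nh] := neq_halfspaces c1C c2C neq.
rewrite -(card_halfspaces C x); apply: leq_trans (leq_card_shattered_halfspaces C x).
by apply: leq_add; apply/IHk/(leq_trans (card_halfspace_lt _ nh)).
Qed.

(** Extremality makes the halving inequalities tight in total, hence tight in each half. *)
Lemma extremal_halfspace C x b : extremal C -> extremal (halfspace C x b).
Proof.
have squeeze (p q p' q' s : nat) : p <= p' -> q <= q' -> p + q = s -> p' + q' <= s ->
  p = p' /\ q = q' by lia.
move=> /eqP exC.
have [e0 e1] := squeeze _ _ _ _ _ (card_leq_shattered (halfspace C x false))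
  (card_leq_shattered (halfspace C x true)) (etrans (card_halfspaces C x) exC)
  (leq_card_shattered_halfspaces C x).
by apply/eqP; case: b; [exact: e1 | exact: e0].
Qed.

Lemma extremal_shatters_halfspace C A x : extremal C -> shatters C A -> x \notin A ->
  exists b, shatters (halfspace C x b) A.
Proof.
move=> exC shA xA.
have sU := shattered_halfspacesU C x; have sI := card_shattered_halfspacesI C x.
have : A \in shattered C :\: [set A : {set 'I_n} | x \in A] by rewrite !inE xA.
suff /eqP <- : shattered (halfspace C x false) :|: shattered (halfspace C x true)
  == shattered C :\: [set A : {set 'I_n} | x \in A].
  by rewrite !inE => /orP[]; [exists false | exists true].
rewrite eqEcard sU /=.
have /eqP e0 := extremal_halfspace x false exC.
have /eqP e1 := extremal_halfspace x true exC.
have squeeze (p q p' q' : nat) : p <= q -> p' + p = q + q' -> q' <= p' by lia.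
apply: squeeze sI _; rewrite cardsUI cardsID.
exact: etrans (etrans (esym (congr2 addn e0 e1)) (card_halfspaces C x)) (eqP exC).
Qed.

(** Halve along coordinates outside [A], keeping [A] shattered, until the remaining concepts agree
    outside [A]; they then fill a cube. *)
Lemma extremal_cube C A : extremal C -> shatters C A ->
  exists p : concept n, forall c : concept n, {in ~: A, c =1 p} -> c \in C.
Proof.
have [k] := ubnP #|C|; elim: k C => // k IHk C ltC exC shA.
have [/existsP[x /andP[xA /forallP nh]]|no] :=
  boolP [exists x, (x \notin A) && [forall b, halfspace C x b != set0]].
  have [b shb] := extremal_shatters_halfspace exC shA xA.
  have [|p cp] := IHk _ _ (extremal_halfspace x b exC) shb.
    exact: leq_trans (card_halfspace_lt b nh) ltC.
  by exists p => c /cp; rewrite inE => /andP[].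
have /shattersP sh := shA; have [p pC _] := sh [ffun => false].
(* No coordinate outside [A] varies any more, so the concept of [C] matching [c] on [A] is [c]
   itself. *)
exists p => c cp; have [c' c'C c'A] := sh c.
suff -> : c = c' by [].
apply/ffunP=> x; have [xA|xA] := boolP (x \in A); first by rewrite c'A.
rewrite cp ?inE //; apply/eqP; apply: contraNT no => neq.
apply/existsP; exists x; rewrite xA; apply/forallP=> b; apply/set0Pn.
have [pb|pb] := eqVneq (p x) b; first by exists p; rewrite inE pC pb eqxx.
exists c'; rewrite inE c'C; move: neq pb.
by case: (p x); case: (c' x); case: b.
Qed.

Definition cut C H := [set c : concept n in C | all (fun xb => c xb.1 == xb.2) H].

Lemma cut_cat C H1 H2 : cut (cut C H1) H2 = cut C (H1 ++ H2).
Proof. by apply/setP=> c; rewrite !inE all_cat andbA. Qed.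

Lemma cut_halfspace C x b : cut C [:: (x, b)] = halfspace C x b.
Proof. by apply/setP=> c; rewrite !inE /= andbT. Qed.

Lemma extremal_cut C H : extremal C -> extremal (cut C H).
Proof.
elim: H C => [|[x b] H IH] C exC.
  suff -> : cut C [::] = C by [].
  by apply/setP=> c; rewrite !inE andbT.
by rewrite -cat1s -cut_cat cut_halfspace; apply/IH/extremal_halfspace.
Qed.

(* Lawrence's lopsidedness: unlike extremality, this form passes immediately to
   sections and to reductions. *)
Definition lopsided C := forall H A, shatters (cut C H) A ->
  exists p : concept n, forall c : concept n, {in ~: A, c =1 p} -> c \in cut C H.

Lemma extremal_lopsided C : extremal C -> lopsided C.
Proof. by move=> exC H A; apply/extremal_cube/extremal_cut. Qed.

Lemma lopsided_cut C H : lopsided C -> lopsided (cut C H).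
Proof. by move=> loC H' A; rewrite cut_cat; apply: loC. Qed.

Definition flip (x : 'I_n) (c : concept n) : concept n :=
  [ffun y => if y == x then ~~ c y else c y].

Lemma flipK x : involutive (flip x).
Proof. by move=> c; apply/ffunP=> y; rewrite !ffunE; case: eqP; rewrite ?negbK. Qed.

Lemma flip_at x c : flip x c x = ~~ c x.
Proof. by rewrite ffunE eqxx. Qed.

Lemma flip_neq x y c : y != x -> flip x c y = c y.
Proof. by rewrite ffunE => /negbTE->. Qed.

(** The edges of [C] in direction [x], each represented by its lower endpoint so that the ambient
    cube is unchanged. *)
Definition reduction C (x : 'I_n) := [set c : concept n in C | ~~ c x && (flip x c \in C)].

(** Patterns on [x |: A] are met by members of the reduction or by their flips, so lopsidedness of
    [C] yields a cube with [x] free; its lower face lies in the reduction. *)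
Lemma lopsided_reduction C x : lopsided C -> lopsided (reduction C x).
Proof.
move=> loC H A /shattersP sh.
(* Constraints at [x] are dropped, since the flipped endpoints would violate them. *)
pose H' := [seq xb <- H | xb.1 != x].
have H'E (c c' : concept n) : {in predC1 x, c =1 c'} -> all (fun xb => c xb.1 == xb.2) H ->
    all (fun xb => c' xb.1 == xb.2) H'.
  move=> eqc /allP cH; apply/allP=> xb; rewrite mem_filter => /andP[xbx xbH].
  by rewrite -eqc ?cH.
have [|p pC] := loC H' (x |: A).
  apply/shattersP=> p; have [c] := sh p.
  rewrite !inE => /andP[/and3P[cC cx fC] cH] cA.
  have xA : x \notin A.
    apply/negP=> xA; have [c1] := sh [ffun => true].
    rewrite !inE => /andP[/and3P[_ c1x _] _] /(_ x xA).
    by rewrite ffunE (negbTE c1x).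
  have neq y : y \in A -> y != x by apply: contraTneq => ->.
  have [px|px] := boolP (p x).
    exists (flip x c); first by rewrite inE fC (H'E c) // => y yx; rewrite flip_neq.
    move=> y; rewrite !inE => /predU1P[->|yA]; first by rewrite flip_at cx px.
    by rewrite flip_neq ?neq // cA.
  exists c; first by rewrite inE cC (H'E c).
  by move=> y; rewrite !inE => /predU1P[->|/cA//]; rewrite (negbTE px) (negbTE cx).
exists [ffun y => if y == x then false else p y] => c cE.
have [c0] := sh [ffun => true]; rewrite !inE => /andP[/and3P[_ c0x _] c0H] c0A.
have xA : x \notin A by apply/negP=> /c0A; rewrite ffunE (negbTE c0x).
have cx : c x = false by rewrite cE ?inE // ffunE eqxx.
have base (e : concept n) : {in predC1 x, c =1 e} -> e \in cut C H'.
  move=> ce; apply: pC => y; rewrite !inE negb_or => /andP[yx yA].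
  by rewrite -ce // cE ?inE // ffunE (negbTE yx).
have /setIdP[cC cH'] : c \in cut C H' by apply: base.
have /setIdP[fC _] : flip x c \in cut C H'.
  by apply: base => y yx; rewrite flip_neq.
rewrite ?inE cC cx fC /=; apply/allP=> xb xbH.
have [xbx|xbx] := eqVneq xb.1 x; last by apply: (allP cH'); rewrite mem_filter xbx.
by have := allP c0H _ xbH; rewrite xbx cx (negbTE c0x).
Qed.

(** Both values at [x] occur, so [[set x]] is shattered and lopsidedness supplies an edge in
    direction [x]. *)
Lemma reduction_neq0 C x : lopsided C -> (forall b, halfspace C x b != set0) ->
  reduction C x != set0.
Proof.
move=> loC nh; have [|p pC] := loC [::] [set x].
  apply/shattersP=> p; have /set0Pn[c] := nh (p x).
  rewrite inE => /andP[cC /eqP cx]; exists c; first by rewrite inE cC.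
  by move=> y; rewrite inE => /eqP->.
have inC (c : concept n) : {in ~: [set x], c =1 p} -> c \in C.
  by move=> /pC; rewrite inE => /andP[].
apply/set0Pn; exists [ffun y => if y == x then false else p y].
rewrite inE ffunE eqxx !inC // => y; rewrite !inE => yx;
  by rewrite ?flip_neq // ffunE (negbTE yx).
Qed.

Lemma reduction_sub C x : reduction C x \subset halfspace C x false.
Proof. by apply/subsetP=> c; rewrite !inE => /and3P[-> /negbTE-> _]. Qed.

End Lopsided.

(** * Cancellation modulo two *)

Section CharacteristicTwo.
Local Open Scope ring_scope.

Lemma addF2 (x : 'F_2) : x + x = 0.
Proof. exact/addrr_pchar2/pchar_Fp. Qed.

Lemma addF2_eq (x y : 'F_2) : x + y = 0 -> x = y.
Proof. by move=> xy; rewrite -[x]addr0 -(addF2 y) addrA xy add0r. Qed.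

Lemma addmxF2 m p (A : 'M['F_2]_(m, p)) : A + A = 0.
Proof. by apply/matrixP=> i j; rewrite !mxE addF2. Qed.

Lemma sumF2_neq0 (I : finType) (P : pred I) (F : I -> 'F_2) :
  \sum_(i | P i) F i != 0 -> exists2 i, P i & F i != 0.
Proof.
move=> nz; case: (pickP [pred i | P i && (F i != 0)]) => [i /andP[Pi Fi]|no].
  by exists i.
by case/eqP: nz; apply: big1 => i Pi; have /= := no i; rewrite Pi /= => /negbFE/eqP.
Qed.

(** Terms cancel in pairs; comparing [enum_rank] selects one representative of each orbit. *)
Lemma sum_involution (M : zmodType) (I : finType) (P : pred I) (h : I -> I) (F : I -> M) :
  (forall x : M, x + x = 0) -> involutive h -> {mono h : i / P i} ->
  (forall i, P i -> h i != i) -> (forall i, P i -> F (h i) = F i) ->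
  \sum_(i | P i) F i = 0.
Proof.
move=> add2 hK Ph h_neq Fh.
rewrite (bigID (fun i => enum_rank i < enum_rank (h i))%N) /=.
rewrite [X in _ + X](reindex_inj (inv_inj hK)) /=.
rewrite -[RHS](add2 (\sum_(i | P i && (enum_rank i < enum_rank (h i))%N) F i)).
congr (_ + _); apply: eq_big => [i|i /andP[Pi _]]; last by apply: Fh; rewrite -Ph.
rewrite Ph hK; have [Pi|//] := boolP (P i); rewrite -leqNgt leq_eqVlt /=.
case: eqP => // /val_inj/enum_rank_inj/esym eq_hi.
by have := h_neq i Pi; rewrite eq_hi eqxx.
Qed.

End CharacteristicTwo.

(** * An abstract van Kampen-Flores obstruction *)

Section Obstruction.
Local Open Scope ring_scope.

(* [B] is the boundary of a reduced complex with empty face [o]; [dim] is the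
   dimension plus one, and [X I] the set of cells in the hull of the points [I]. *)
Variables (m : nat) (B : 'M['F_2]_m) (dim : 'I_m -> nat) (o : 'I_m).
Variables (V : finType) (X : {set V} -> 'I_m -> Prop) (d : nat).

Hypothesis BB : B *m B = 0.
Hypothesis dimB : forall i j, B i j != 0 -> dim j = (dim i).+1.
Hypothesis dimo : dim o = 0%N.
Hypothesis Xo : forall I, X I o.
Hypothesis X_face : forall I i j, B i j != 0 -> X I j -> X I i.
Hypothesis X_mono : forall (I J : {set V}) i, I \subset J -> X I i -> X J i.
Hypothesis X_disj : forall (I J : {set V}) i, [disjoint I & J] -> X I i -> X J i -> i = o.
Hypothesis X_dim : forall I i, X I i -> (dim i <= d.+1)%N.
Hypothesis X_fill : forall (I : {set V}) (z : 'cV['F_2]_m), I != set0 ->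
  (forall i, z i 0 != 0 -> X I i) -> B *m z = 0 ->
  exists2 w : 'cV_m, forall i, w i 0 != 0 -> X I i & B *m w = z.

Definition carried (I : {set V}) k (z : 'cV['F_2]_m) :=
  forall i, z i 0 != 0 -> X I i /\ dim i = k.

(** [B] shifts the grading by one, so truncating a filling to degree [k.+1] does not change its
    boundary. *)
Lemma fill_carried I k z : I != set0 -> carried I k z -> B *m z = 0 ->
  exists2 w, carried I k.+1 w & B *m w = z.
Proof.
move=> nI cz Bz; have [|w wX Bw] := X_fill nI _ Bz; first by move=> i /cz[].
exists (\col_i (if dim i == k.+1 then w i 0 else 0)) => [i|].
  by rewrite mxE; case: (dim i =P k.+1) => [-> /wX|_ /eqP].
apply/matrixP=> i j; rewrite !ord1 {j}.
have [dik|dik] := eqVneq (dim i) k.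
  rewrite -Bw !mxE; apply: eq_bigr => j _; rewrite !mxE; case: eqP => // dj.
  have [->|/dimB djE] := eqVneq (B i j) 0; first by rewrite !mul0r.
  by rewrite djE dik in dj.
have [->|/cz[_ dimi]] := eqVneq (z i 0) 0; last by rewrite dimi eqxx in dik.
rewrite mxE big1 // => j _; rewrite mxE.
have [->|/dimB djE] := eqVneq (B i j) 0; first by rewrite mul0r.
by rewrite djE eqSS (negbTE dik) mulr0.
Qed.

(** The condition at the face [I] for [phi] to be an augmented chain map from the simplex on [V],
    carried by the hulls. *)
Definition simplex_map (phi : {set V} -> 'cV['F_2]_m) I :=
  carried I #|I| (phi I) /\ B *m phi I = \sum_(i in I) phi (I :\ i).

Lemma simplex_map_boundary phi (I : {set V}) k : #|I| = k.+1 ->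
  (forall J : {set V}, (#|J| <= k)%N -> simplex_map phi J) ->
  carried I k (\sum_(i in I) phi (I :\ i)) /\ B *m (\sum_(i in I) phi (I :\ i)) = 0.
Proof.
move=> cardI phiP.
have card_face i : i \in I -> #|I :\ i| = k by move=> iI; have := cardsD1 i I; rewrite iI; lia.
split=> [j|].
  rewrite summxE => /sumF2_neq0[i iI phi_ij].
  have [|cphi _] := phiP (I :\ i); first by rewrite card_face.
  have [Xj dj] := cphi j phi_ij; rewrite card_face // in dj; split=> //.
  by apply: X_mono Xj; rewrite subD1set.
rewrite mulmx_sumr (eq_bigr (fun i => \sum_(j in I :\ i) phi (I :\ i :\ j))); last first.
  by move=> i iI; have [|_ ->] := phiP (I :\ i); rewrite ?card_face.
rewrite pair_big_dep /=.
apply: (@sum_involution _ _ _ (fun p => (p.2, p.1))) => [|[]|[i j]|[i j]|[i j] _] //=.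
- exact: addmxF2.
- by rewrite !inE eq_sym; case: (j \in I); case: (i \in I); rewrite ?andbF ?andbT.
- by rewrite !inE => /and3P[_ neq _]; apply: contraNneq neq => -[->].
- by congr phi; rewrite !setDDl setUC.
Qed.

(** The method of acyclic carriers: by induction on the size of [I], fill the image of its boundary
    inside the hull of [I]. *)
Lemma simplex_map_exists :
  exists2 phi, phi set0 = delta_mx o 0 & forall I, simplex_map phi I.
Proof.
suff /(_ #|V|)[phi phi0 phiP] : forall k, exists2 phi, phi set0 = delta_mx o 0 &
    forall I : {set V}, (#|I| <= k)%N -> simplex_map phi I.
  by exists phi => // I; apply/phiP/max_card.
elim=> [|k [phi phi0 phiP]].
  exists (fun=> delta_mx o 0) => // I; rewrite leqn0 cards_eq0 => /eqP->.
  split=> [i|].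
    by rewrite mxE cards0 andbT; case: (i =P o) => [-> _|_ /eqP].
  rewrite big_set0; apply/matrixP=> i j; rewrite !mxE; apply: big1 => l _.
  have [->|/dimB] := eqVneq (B i l) 0; first by rewrite mul0r.
  by rewrite mxE; case: eqP => [->|_ _]; rewrite ?dimo ?mulr0.
have /fin_all_exists[psi psiP] : forall I : {set V}, exists w,
    ((#|I| <= k)%N -> w = phi I) /\
    (#|I| = k.+1 -> carried I k.+1 w /\ B *m w = \sum_(i in I) phi (I :\ i)).
  move=> I; have [leI|ltI] := leqP #|I| k.
    by exists (phi I); split=> // eqI; rewrite eqI ltnn in leI.
  have [eqI|neqI] := eqVneq #|I| k.+1; last first.
    by exists 0; split=> // eqI; rewrite eqI eqxx in neqI.
  have [cz Bz] := simplex_map_boundary eqI phiP.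
  have [|w cw Bw] := fill_carried _ cz Bz; first by rewrite -cards_eq0 eqI.
  by exists w; split.
exists psi => [|I leI]; first by have [->] := psiP set0; rewrite ?cards0.
have phi_face i : i \in I -> psi (I :\ i) = phi (I :\ i).
  by move=> iI; have [-> //] := psiP (I :\ i); have := cardsD1 i I; rewrite iI; lia.
rewrite /simplex_map (eq_bigr _ phi_face).
move: leI; rewrite leq_eqVlt => /predU1P[eqI|ltI].
  by have [_ /(_ eqI)] := psiP I; rewrite eqI.
by have [/(_ ltI) -> _] := psiP I; apply: phiP.
Qed.

(* Matrices are chains of the join of the complex with itself, and transposition
   swaps the two factors. *)
Definition bdmx (W : 'M['F_2]_m) := B *m W + W *m B^T.

Lemma bdmxD W1 W2 : bdmx (W1 + W2) = bdmx W1 + bdmx W2.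
Proof. by rewrite /bdmx mulmxDr mulmxDl addrACA. Qed.

Lemma bdmx_tr W : bdmx W^T = (bdmx W)^T.
Proof. by rewrite /bdmx linearD /= !trmx_mul trmxK addrC. Qed.

Lemma bdmxK W : bdmx (bdmx W) = 0.
Proof.
rewrite /bdmx !mulmxDr !mulmxDl !mulmxA BB mul0mx add0r addrA addmxF2 add0r.
by rewrite -mulmxA -trmx_mul BB trmx0 mulmx0.
Qed.

(** Degree [k] chains of the join supported on hulls of disjoint vertex sets; by [X_disj] the only
    diagonal pair left is that of empty faces. *)
Definition deleted k (W : 'M['F_2]_m) := forall i j, W i j != 0 ->
  (exists I J : {set V}, [/\ [disjoint I & J], X I i & X J j]) /\ (dim i + dim j = k)%N.

Lemma deletedD k W1 W2 : deleted k W1 -> deleted k W2 -> deleted k (W1 + W2).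
Proof.
move=> W1P W2P i j; rewrite mxE.
have [->|/W1P //] := eqVneq (W1 i j) 0; by rewrite add0r => /W2P.
Qed.

Lemma deleted_bdmx k W : deleted k.+1 W -> deleted k (bdmx W).
Proof.
move=> WP; apply: deletedD => i j; rewrite mxE => /sumF2_neq0[l _].
  rewrite mulf_eq0 negb_or => /andP[Bil /WP[[I [J [dIJ XI XJ]]] dimW]]; split.
    by exists I, J; split=> //; apply: X_face XI.
  by have := dimB Bil; lia.
rewrite mulf_eq0 negb_or mxE => /andP[/WP[[I [J [dIJ XI XJ]]] dimW] Bjl]; split.
  by exists I, J; split=> //; apply: X_face XJ.
by have := dimB Bjl; lia.
Qed.

(* The swap acts freely away from the pair of empty faces. *)
Lemma deleted_halve k W : deleted k.+1 W -> W^T = W ->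
  exists2 U, deleted k.+1 U & W = U + U^T.
Proof.
move=> WP symW; exists (\matrix_(i, j) if (i < j)%N then W i j else 0) => [i j|].
  by rewrite mxE; case: ifP => [_ /WP|]; rewrite ?eqxx.
apply/matrixP=> i j; rewrite !mxE; case: ltngtP => [||/val_inj <-].
- by rewrite addr0.
- by rewrite add0r -{1}symW mxE.
rewrite addr0; apply/eqP; apply: contraTT isT => /WP[[I [J [dIJ XI XJ]]]].
by rewrite (X_disj dIJ XI XJ) dimo.
Qed.

(** * The sphere, its hemispheres and the equivariant descent *)

Section Sphere.
Variable phi : {set V} -> 'cV['F_2]_m.
Hypothesis phi0 : phi set0 = delta_mx o 0.
Hypothesis phiP : forall I, simplex_map phi I.

(* The vertices of the deleted join of a simplex are two copies of its vertices:
   it is the boundary of a cross-polytope, with fundamental cycle the sum of all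
   [(A :\: J) * J]. *)
Definition sphere (A : {set V}) : 'M_m :=
  \sum_(J : {set V} | J \subset A) phi (A :\: J) *m (phi J)^T.

(** The cone over [sphere A] whose apex is the copy of [v] in the first factor. *)
Definition hemisphere (A : {set V}) v : 'M_m :=
  \sum_(J : {set V} | J \subset A) phi (v |: (A :\: J)) *m (phi J)^T.

Lemma sphere_tr A : (sphere A)^T = sphere A.
Proof.
rewrite /sphere linear_sum /=.
rewrite (reindex_onto (fun J => A :\: J) (fun J => A :\: J)) /=; last first.
  by move=> J /setIidPr JA; rewrite setDDr setDv set0U.
have DD J : A :\: (A :\: J) = A :&: J by rewrite setDDr setDv set0U.
apply: eq_big => [J|J /andP[_ /eqP JA]].
  by rewrite subsetDl DD; exact/eqP/setIidPr.
by rewrite JA trmx_mul trmxK.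
Qed.

(** The terms with [v] in the first factor form one hemisphere, the others its transpose. *)
Lemma sphere_setU1 (A : {set V}) v : v \notin A ->
  sphere (v |: A) = hemisphere A v + (hemisphere A v)^T.
Proof.
move=> vA; rewrite /sphere (bigID (fun J : {set V} => v \notin J)) /=.
congr (_ + _).
  apply: eq_big => [J|J /andP[_ vJ]].
    apply/andP/idP => [[JvA vJ]|JA].
      by rewrite -(setU1K vA) subsetD1 JvA.
    split; first by rewrite subsetU // JA orbT.
    by apply: contra vA; apply: subsetP.
  by congr (phi _ *m _); rewrite setDUl setDE (setIidPl _) // sub1set inE.
rewrite /hemisphere linear_sum /=.
rewrite (reindex_onto (fun J => v |: (A :\: J)) (fun J => A :\: J)) /=; last first.
  move=> J /andP[JvA /negbNE vJ]; apply/setP=> x; rewrite !inE negb_and negbK.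
  have := subsetP JvA x; rewrite !inE; have [->|_] := eqVneq x v; first by rewrite vJ.
  by case: (x \in J); case: (x \in A) => //= /(_ isT).
have DD J : A :\: (v |: (A :\: J)) = A :&: J.
  apply/setP=> x; rewrite !inE; have [->|_] := eqVneq x v; first by rewrite (negbTE vA).
  by case: (x \in J); case: (x \in A).
apply: eq_big => [J|J /andP[_ /eqP]]; rewrite DD.
  rewrite setU11 setUS ?subsetDl //=; exact/eqP/setIidPr.
move=> JA; rewrite trmx_mul trmxK; congr (phi _ *m _).
rewrite -{2}JA -DD; apply/setP=> x; rewrite !inE; by case: eqVneq => //.
Qed.

(** Deleting [v] leaves the sphere. The other faces cancel: deleting [i] from the first factor at
    [J] matches deleting it from the second at [i |: J]. *)
Lemma bdmx_hemisphere (A : {set V}) v : v \notin A -> bdmx (hemisphere A v) = sphere A.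
Proof.
move=> vA; rewrite /bdmx /hemisphere mulmx_sumr mulmx_suml.
rewrite (eq_bigr (fun J : {set V} => phi (A :\: J) *m (phi J)^T +
    \sum_(i in A :\: J) phi ((v |: (A :\: J)) :\ i) *m (phi J)^T)); last first.
  move=> J JA; have vAJ : v \notin A :\: J by rewrite inE (negbTE vA) andbF.
  rewrite mulmxA (phiP _).2 big_setU1 //= setU1K // mulmxDl; congr (_ + _).
  by rewrite mulmx_suml.
rewrite big_split /= -addrA -[RHS]addr0; congr (_ + _).
rewrite [X in _ + X](eq_bigr (fun J : {set V} => \sum_(i in J)
    phi (v |: (A :\: J)) *m (phi (J :\ i))^T)); last first.
  move=> J JA; rewrite -mulmxA -trmx_mul (phiP _).2 linear_sum /= mulmx_sumr.
  by [].
rewrite (exchange_big_dep predT) //= [X in _ + X](exchange_big_dep predT) //=.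
rewrite -big_split /= big1 // => i _.
rewrite [X in _ + X](reindex_onto (fun J => i |: J) (fun J => J :\ i)) /=; last first.
  by move=> J /andP[_ iJ]; rewrite setD1K.
rewrite -[RHS](addmxF2 (\sum_(J : {set V} | (J \subset A) && (i \in A :\: J))
  phi ((v |: A :\: J) :\ i) *m (phi J)^T)).
congr (_ + _); apply: eq_big => [J|J /andP[/andP[iJA _] /eqP iJ]].
  rewrite setU11 andbT subUset sub1set inE.
  have [iJ|iJ] := boolP (i \in J); last by rewrite setU1K // eqxx andbT andbC.
  rewrite andbF; apply/negP=> /andP[_ /eqP/setP/(_ i)]; by rewrite !inE eqxx iJ.
rewrite iJ; congr (phi _ *m _); apply/setP=> x; rewrite !inE.
have iA : i \in A by apply: (subsetP iJA); rewrite setU11.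
have iv : i != v by apply: contraNneq vA => <-.
by have [->|_] := eqVneq x i; [rewrite (negbTE iv)|].
Qed.

Lemma phi_neq0 I i : phi I i 0 != 0 -> X I i /\ dim i = #|I|.
Proof. by have [cI _] := phiP I; apply: cI. Qed.

Lemma outer_neq0 (u w : 'cV['F_2]_m) i j :
  (u *m w^T) i j != 0 -> u i 0 != 0 /\ w j 0 != 0.
Proof. by rewrite mxE big_ord1 mxE mulf_eq0 negb_or => /andP[]. Qed.

Lemma deleted_hemisphere (A : {set V}) v : v \notin A -> deleted #|A|.+1 (hemisphere A v).
Proof.
move=> vA i j; rewrite summxE => /sumF2_neq0[J JA].
case/outer_neq0=> /phi_neq0[Xi di] /phi_neq0[Xj dj].
have vAJ : v \notin A :\: J by rewrite inE (negbTE vA) andbF.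
split; last first.
  by rewrite di dj cardsU1 vAJ cardsD (setIidPr JA); have := subset_leq_card JA; lia.
exists (v |: (A :\: J)), J; split=> //.
rewrite -setI_eq0 setIUl setIDAC setDIl setDv setI0 setU0 setI_eq0 disjoints1.
by apply: contra vA; apply: subsetP.
Qed.

(** With [2d + 2] vertices both factors have top degree. The sphere is a cycle whose two partial
    boundaries live in different bidegrees, so each vanishes; a filling of a column would exceed the
    dimension bound unless zero. *)
Lemma sphere_full : #|V| = d.*2.+2 -> sphere setT = 0.
Proof.
move=> cardV.
have dim_sphere i j : sphere setT i j != 0 -> dim i = d.+1 /\ dim j = d.+1.
  rewrite summxE => /sumF2_neq0[J _ /outer_neq0[/phi_neq0[Xi di] /phi_neq0[Xj dj]]].
  have := X_dim Xi; have := X_dim Xj; rewrite di dj cardsD setTI cardsT cardV; lia.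
have [v _] : exists v : V, v \in V by apply/card_gt0P; rewrite cardV.
have bd0 : bdmx (sphere setT) = 0.
  have vT : v \notin [set~ v] by rewrite !inE eqxx.
  have -> : setT = v |: [set~ v] by apply/setP=> x; rewrite !inE orbN.
  by rewrite sphere_setU1 // bdmxD bdmx_tr bdmx_hemisphere // sphere_tr addmxF2.
have B0 : B *m sphere setT = 0.
  apply/matrixP=> i j; rewrite [RHS]mxE; apply/eqP.
  apply: contraTT isT => nz; have := nz; rewrite mxE => /sumF2_neq0[l _].
  rewrite mulf_eq0 negb_or => /andP[/dimB Bil /dim_sphere[dl dj]].
  have : (sphere setT *m B^T) i j != 0.
    have := congr1 (fun W : 'M_m => W i j) bd0; rewrite mxE [RHS]mxE.
    by apply: contra_eq_neq => ->; rewrite addr0.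
  rewrite mxE => /sumF2_neq0[l' _]; rewrite mulf_eq0 negb_or => /andP[/dim_sphere[di _] _].
  by lia.
apply/matrixP=> i j; rewrite [RHS]mxE.
have [|||w cw Bw] := @fill_carried setT d.+1 (col j (sphere setT)).
- by apply/set0Pn; exists v.
- move=> l; rewrite mxE => nz; have [dl _] := dim_sphere _ _ nz; split=> //.
  move: nz; rewrite summxE => /sumF2_neq0[J _ /outer_neq0[/phi_neq0[Xi di] _]].
  by apply: X_mono Xi; exact: subsetT.
- by rewrite colE mulmxA B0 mul0mx.
have -> : sphere setT i j = col j (sphere setT) i 0 by rewrite mxE.
rewrite -Bw mxE big1 // => l _.
have [->|/cw[Xl dl]] := eqVneq (w l 0) 0; first by rewrite mulr0.
by have := X_dim Xl; rewrite dl ltnn.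
Qed.

(** The hemisphere plus [bdmx W] is symmetric; halving it and taking boundaries passes to the
    equator. *)
Lemma sphere_descent (A : {set V}) v : v \notin A ->
  (exists2 W, deleted #|A|.+2 W & sphere (v |: A) = bdmx W + (bdmx W)^T) ->
  exists2 W, deleted #|A|.+1 W & sphere A = bdmx W + (bdmx W)^T.
Proof.
move=> vA [W Wdel]; rewrite sphere_setU1 // => eqW.
have [||U Udel eqU] := @deleted_halve #|A| (hemisphere A v + bdmx W).
- by apply: deletedD; [exact: deleted_hemisphere | exact: deleted_bdmx].
- rewrite linearD /=; apply/eqP; rewrite -subr_eq0 opprD addrACA.
  have opp (M : 'M['F_2]_m) : - M = M by apply/eqP; rewrite eq_sym -addr_eq0 addmxF2.
  by rewrite !opp (addrC _ (hemisphere A v)) (addrC _ (bdmx W)) eqW addmxF2.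
exists U => //.
rewrite -(bdmx_hemisphere vA) -bdmx_tr -bdmxD -eqU bdmxD bdmxK addr0.
by [].
Qed.

(** Descend from the vanishing top sphere. On the empty set the sphere has diagonal entry one at
    [o], whereas a matrix plus its transpose has zero diagonal. *)
Lemma sphere_obstruction : #|V| <> d.*2.+2.
Proof.
move=> cardV.
have [W _] : exists2 W, deleted #|@set0 V|.+1 W & sphere set0 = bdmx W + (bdmx W)^T.
  suff : forall k (A : {set V}), #|~: A| = k ->
      exists2 W, deleted #|A|.+1 W & sphere A = bdmx W + (bdmx W)^T by move=> /(_ _ _ erefl).
  elim=> [|k IHk] A cardA.
    have -> : A = setT by rewrite -[A]setCK (cards0_eq cardA) setC0.
    exists 0; first by move=> i j; rewrite mxE eqxx.
    by rewrite sphere_full // /bdmx mulmx0 mul0mx add0r trmx0 add0r.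
  have [v vA] : exists v, v \in ~: A by apply/card_gt0P; rewrite cardA.
  have {}vA' : v \notin A by rewrite inE in vA.
  apply: (sphere_descent vA').
  have := IHk (v |: A); rewrite cardsU1 vA'; apply.
  have := cardsC A; have := cardsC (v |: A); rewrite cardsU1 vA' cardA; lia.
move/matrixP/(_ o o); rewrite !mxE addF2.
have -> : sphere set0 o o = 1.
  rewrite /sphere (big_pred1 set0) => [|J]; last by rewrite subset0.
  by rewrite setD0 phi0 !mxE big_ord1 !mxE !eqxx mulr1.
by move/eqP; rewrite oner_eq0.
Qed.

End Sphere.

Lemma radon_obstruction : #|V| <> d.*2.+2.
Proof.
by have [phi phi0 phiP] := simplex_map_exists; apply: sphere_obstruction phi0 phiP.
Qed.

End Obstruction.

(** * Cubical chains modulo two and acyclicity of lopsided classes *)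

Section Cubes.
Local Open Scope ring_scope.
Variable n : nat.
Implicit Types (C : {set concept n}).

(* [t x = None] means that the coordinate [x] is free. As a cell, [None] is the
   empty face, so that all homology is reduced; [cell_dim] is the dimension
   plus one. *)
Definition cube := {ffun 'I_n -> option bool}.
Definition cell := option cube.
Definition chain := {ffun cell -> 'F_2}.

Definition vertex (c : concept n) : cube := [ffun x => Some (c x)].
Definition assign (o : option bool) (t : cube) (x : 'I_n) : cube :=
  [ffun y => if y == x then o else t y].
Notation free := (assign None).

Definition fits (c : concept n) (t : cube) := forall x b, t x = Some b -> c x = b.

Definition inside C (s : cell) :=
  if s is Some t then forall c, fits c t -> c \in C else True.

Definition facet (s s' : cell) :=
  if s is Some t then exists2 x, t x != None & s' = Some (free t x)
  else exists c, s' = Some (vertex c).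

Definition cell_dim (s : cell) : nat :=
  if s is Some t then #|[set x | t x == None]|.+1 else 0.

(** Written by coefficients: the value at a cell sums [z] over the cells of which it is a facet; at
    the empty face this is the augmentation. *)
Definition bd (z : chain) : chain := [ffun s : cell =>
  if s is Some t then \sum_(x | t x != None) z (Some (free t x))
  else \sum_c z (Some (vertex c))].

Lemma bd_neq0 z s : bd z s != 0 -> exists2 s', facet s s' & z s' != 0.
Proof.
rewrite ffunE; case: s => [t|] /sumF2_neq0[x tx zx].
  by exists (Some (free t x)) => //; exists x.
by exists (Some (vertex x)) => //; exists x.
Qed.

Lemma bdD z w : bd (z + w) = bd z + bd w.
Proof.
apply/ffunP=> -[t|]; rewrite !ffunE -big_split; apply: eq_bigr => x _; by rewrite ffunE.
Qed.

Lemma addchainF2 (z : chain) : z + z = 0.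
Proof. by apply/ffunP=> s; rewrite !ffunE addF2. Qed.

(** Two coordinates can be freed in either order, and at the empty face each edge counts its two
    endpoints. *)
Lemma bdK z : bd (bd z) = 0.
Proof.
apply/ffunP=> -[t|]; rewrite [RHS]ffunE ffunE.
  rewrite (eq_bigr (fun x => \sum_(y | free t x y != None) z (Some (free (free t x) y))));
    last by move=> x _; rewrite ffunE.
  rewrite pair_big_dep /=.
  apply: (@sum_involution _ _ _ (fun p => (p.2, p.1))) => [|[]|[x y]|[x y]|[x y]] //=.
  - exact: addF2.
  - by rewrite !ffunE [x == y]eq_sym; case: (y == x); rewrite ?eqxx ?andbF // andbC.
  - by rewrite ffunE => /andP[_]; apply: contraNneq => -[->]; rewrite eqxx.
  - move=> _; congr (z (Some _)); apply/ffunP=> u; rewrite !ffunE.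
    by case: (u == x); case: (u == y).
rewrite (eq_bigr (fun c => \sum_x z (Some (free (vertex c) x)))); last first.
  by move=> c _; rewrite ffunE; apply: eq_bigl => x; rewrite ffunE.
rewrite exchange_big /= big1 // => x _.
apply: (sum_involution addF2 (flipK x)) => // c _.
  by apply: contraTneq isT => /ffunP/(_ x); rewrite flip_at; case: (c x).
congr (z (Some _)); apply/ffunP=> y; rewrite !ffunE; by case: eqP.
Qed.

Lemma inside_sub C1 C2 s : C1 \subset C2 -> inside C1 s -> inside C2 s.
Proof. by move=> /subsetP sC; case: s => //= t inC c /inC/sC. Qed.

Lemma inside_facet C s s' : facet s s' -> inside C s' -> inside C s.
Proof.
case: s => [t [x tx ->] /= inC c ct|//]; apply: inC => y b.
by rewrite ffunE; case: eqP => // _ /ct.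
Qed.

Lemma cell_dim_facet s s' : facet s s' -> cell_dim s' = (cell_dim s).+1.
Proof.
case: s => [t [x tx ->]|[c ->]] /=; congr _.+1.
  rewrite (cardsD1 x) !inE ffunE eqxx eqxx add1n; congr _.+1.
  apply: eq_card => y; rewrite !inE ffunE; case: eqVneq => //= ->.
  by rewrite (negbTE tx).
by apply: eq_card0 => x; rewrite !inE ffunE.
Qed.

Lemma fits_odflt (t : cube) (p : concept n) : fits [ffun x => odflt (p x) (t x)] t.
Proof. by move=> x b tx; rewrite ffunE tx. Qed.

Lemma inside_const C (t : cube) x b : (forall c, c \in C -> c x = b) ->
  inside C (Some t) -> t x = Some b.
Proof.
move=> Cx inC; have := Cx _ (inC _ (@fits_odflt t [ffun => ~~ b])).
by rewrite !ffunE; case: (t x) => [b' /= ->|/=] //; case: b {Cx}.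
Qed.

Lemma cell_dim_inside C s : inside C s -> (cell_dim s <= (vc C).+1)%N.
Proof.
case: s => //= t inC; rewrite ltnS /vc.
apply: (@leq_bigmax_cond _ _ (fun A : {set 'I_n} => #|A|) [set x | t x == None]).
apply/shattersP=> p.
exists [ffun x => odflt (p x) (t x)]; first by apply/inC/fits_odflt.
by move=> x; rewrite inE ffunE => /eqP->.
Qed.

Definition supported C (z : chain) := forall s, z s != 0 -> inside C s.

Lemma supportedD C z w : supported C z -> supported C w -> supported C (z + w).
Proof.
move=> zC wC s; rewrite ffunE; have [->|/zC //] := eqVneq (z s) 0.
by rewrite add0r => /wC.
Qed.

Lemma supported_bd C z : supported C z -> supported C (bd z).
Proof. by move=> zC s /bd_neq0[s' /inside_facet ss' /zC/ss']. Qed.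

Lemma supported_sub C1 C2 z : C1 \subset C2 -> supported C1 z -> supported C2 z.
Proof. by move=> sC zC s /zC; apply: inside_sub. Qed.

(** Only the empty face and one vertex are available, and the augmentation kills the coefficient of
    that vertex in a cycle. *)
Lemma fill_single c z : supported [set c] z -> bd z = 0 ->
  exists2 w, supported [set c] w & bd w = z.
Proof.
move=> zC bz.
have in1 t : inside [set c] (Some t) -> t = vertex c.
  move=> inc; apply/ffunP=> x; rewrite ffunE.
  by apply: inside_const inc => _ /set1P->.
have vinj : injective vertex.
  by move=> c1 c2 /ffunP eqc; apply/ffunP=> x; have := eqc x; rewrite !ffunE => -[].
have z0 t : z (Some t) = 0.
  apply/eqP; apply: contraTT isT => nz; have tE := in1 _ (zC _ nz).
  have := congr1 (fun u : chain => u None) bz; rewrite !ffunE (bigD1 c) //= big1.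
    by rewrite addr0 -tE => /eqP; rewrite (negbTE nz).
  move=> c' neq; apply/eqP; apply: contraNT neq => /zC/in1/vinj->.
  exact: eqxx.
exists [ffun s => if s == Some (vertex c) then z None else 0].
  move=> s; rewrite ffunE; case: (s =P _) => [-> _ c' fc|_ /eqP//].
  by rewrite inE; apply/eqP/ffunP=> x; apply: fc; rewrite ffunE.
apply/ffunP=> -[t|]; rewrite ffunE.
  rewrite z0 big1 // => x _; rewrite ffunE; case: eqP => // -[/ffunP/(_ x)].
  by rewrite !ffunE eqxx.
rewrite (bigD1 c) //= big1 ?addr0 ?ffunE ?eqxx // => c' neq.
by rewrite ffunE; case: eqP => // -[/vinj cc]; rewrite cc eqxx in neq.
Qed.

(** * Splitting a cycle along one coordinate *)

Section Split.
Variables (C : {set concept n}) (x : 'I_n) (z : chain).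
Hypotheses (zC : supported C z) (bz : bd z = 0).

Definition lower : chain := [ffun s : cell =>
  (if s is Some t then if t x == Some false then z s else 0 else 0) : 'F_2].

Lemma supported_lower : supported (halfspace C x false) lower.
Proof.
move=> s; rewrite ffunE; case: s => [t|/eqP//].
case: (t x =P _) => [tx zt c ct|_ /eqP//].
by rewrite inE (ct _ _ tx) (zC zt).
Qed.

(** The cycle equation at [t] isolates the term that frees [x]; all its other terms come from cells
    of [lower]. *)
Lemma bd_lower (t : cube) : t x = Some false -> bd lower (Some t) = z (Some (free t x)).
Proof.
move=> tx; have := congr1 (fun u : chain => u (Some t)) bz; rewrite ffunE [RHS]ffunE.
rewrite ffunE (bigD1 x) ?tx //= => zt; rewrite (bigD1 x) ?tx //=.
rewrite [lower _]ffunE ffunE eqxx add0r.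
rewrite (eq_bigr (fun y => z (Some (free t y)))).
  exact/esym/addF2_eq.
by move=> y /andP[_ yx]; rewrite !ffunE [x == y]eq_sym (negbTE yx) tx eqxx.
Qed.

Lemma supported_bd_lower : supported (reduction C x) (bd lower).
Proof.
case=> [t|//] nz; have tx : t x = Some false.
  have /bd_neq0[s [y ty ->]] := nz; rewrite !ffunE.
  by case: (x == y) => //=; case: (t x =P _) => // _ /eqP.
move: nz; rewrite bd_lower // => /zC inC c ct.
have int : inside C (Some t) by apply: inside_facet inC; exists x; rewrite ?tx.
have cC : c \in C := int c ct.
rewrite inE cC (ct _ _ tx) /=; apply: inC => y b; rewrite ffunE.
by case: (eqVneq y x) => // yx /ct <-; rewrite flip_neq.
Qed.

Variable w : chain.
Hypotheses (wR : supported (reduction C x) w) (bw : bd w = bd lower).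

(* The chain [w] on the reduction, thickened in direction [x]. *)
Definition prism : chain := [ffun s : cell =>
  (if s is Some t then if t x == None then w (Some (assign (Some false) t x)) else 0
   else 0) : 'F_2].

Lemma reduction_chain_at (t : cube) : w (Some t) != 0 -> t x = Some false.
Proof.
by move/wR; apply: inside_const => c; rewrite inE => /and3P[_ /negbTE].
Qed.

Lemma supported_prism : supported C prism.
Proof.
move=> s; rewrite ffunE; case: s => [t|/eqP//].
case: (t x =P _) => [tx /wR inR c ct|_ /eqP//].
have ft (c' : concept n) : {in predC1 x, c =1 c'} -> c' x = false ->
    fits c' (assign (Some false) t x).
  move=> eqc c'x y b; rewrite ffunE; case: (eqVneq y x) => [-> [<-]//|yx /ct <-].
  by rewrite -eqc.
case cx: (c x).
  have : flip x c \in reduction C x.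
    by apply: inR; apply: ft; rewrite ?flip_at ?cx // => y yx; rewrite flip_neq.
  by rewrite inE flipK => /and3P[].
by have := inR _ (ft c (fun _ _ => erefl) cx); rewrite inE => /and3P[].
Qed.

(** Among cells spanning [x], the prism boundary copies that of [w], hence that of [lower], which
    records these cells of [z]. *)
Lemma bd_prism_free (t : cube) : t x = None -> bd prism (Some t) = z (Some t).
Proof.
move=> tx; have atx : assign (Some false) t x x = Some false by rewrite ffunE eqxx.
have freeE : free (assign (Some false) t x) x = t.
  by apply/ffunP=> y; rewrite !ffunE; case: eqP => // ->.
rewrite -{2}freeE -bd_lower // -bw !ffunE [RHS](bigD1 x) ?atx //= freeE.
have -> : w (Some t) = 0 by apply/eqP; apply: contraTT isT => /reduction_chain_at; rewrite tx.
rewrite add0r; apply: eq_big => [y|y ty].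
  by rewrite ffunE; case: (eqVneq y x) => [->|_]; rewrite ?tx ?andbT.
rewrite !ffunE tx if_same eqxx; congr (w (Some _)).
apply/ffunP=> u; rewrite !ffunE; case: (eqVneq u x) => [->|//].
by case: (eqVneq x y) ty => [<-|//]; rewrite tx.
Qed.

Lemma bd_prism_lower (t : cube) : t x = Some false -> bd prism (Some t) = w (Some t).
Proof.
move=> tx; rewrite ffunE (bigD1 x) ?tx //= big1 => [|y /andP[_ yx]].
  rewrite addr0 !ffunE eqxx; congr (w (Some _)).
  by apply/ffunP=> y; rewrite !ffunE; case: eqP => // ->.
by rewrite !ffunE [x == y]eq_sym (negbTE yx) tx.
Qed.

(** The prism boundary removes the cells of [z] spanning [x] and adds [w] at the value [false]; the
    term [lower + w] clears what is left there. *)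
Lemma supported_upper : supported (halfspace C x true) (z + bd prism + (lower + w)).
Proof.
have inC : supported C (z + bd prism + (lower + w)).
  have := halfspace_sub C x false; have := reduction_sub C x => sR sH.
  apply: supportedD; first by apply: supportedD => //; apply/supported_bd/supported_prism.
  apply: supportedD; first exact: supported_sub sH supported_lower.
  by apply: supported_sub wR; apply: subset_trans sH.
case=> [t|//] nz; have int := inC _ nz.
move: nz; rewrite !ffunE -/bd; case tx: (t x) => [[]|] nz.
- by move=> c ct; rewrite inE (ct _ _ tx) int.
- move: nz; have := bd_prism_lower tx; rewrite ffunE => ->.
  by rewrite eqxx addF2 eqxx.
move: nz; have := bd_prism_free tx; rewrite ffunE => ->.
rewrite add0r addF2 add0r => /reduction_chain_at; by rewrite tx.
Qed.

End Split.

(** Mayer-Vietoris by induction on [#|C|]: the two half-spaces are glued along the reduction, and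
    all three are smaller and lopsided. *)
Lemma lopsided_acyclic C : lopsided C -> C != set0 ->
  forall z, supported C z -> bd z = 0 -> exists2 w, supported C w & bd w = z.
Proof.
have [k] := ubnP #|C|; elim: k C => // k IHk C ltC loC nC z zC bz.
have [le1|] := leqP #|C| 1.
  have /cards1P[c defC] : #|C| == 1%N by rewrite eqn_leq le1 card_gt0.
  by move: zC; rewrite defC => zC; apply: fill_single.
case/card_gt1P=> c1 [c2 [c1C c2C neq]].
have [x nh] := neq_halfspaces c1C c2C neq.
have lt b : (#|halfspace C x b| < k)%N := leq_trans (card_halfspace_lt b nh) ltC.
have loH b : lopsided (halfspace C x b) by rewrite -cut_halfspace; apply: lopsided_cut.
have ltR : (#|reduction C x| < k)%N.
  exact: leq_ltn_trans (subset_leq_card (reduction_sub C x)) (lt false).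
(* Filling inside the reduction turns [lower + w] into a cycle of the lower half. *)
have [w wR bw] := IHk _ ltR (lopsided_reduction loC) (reduction_neq0 loC nh) _
  (supported_bd_lower zC bz) (bdK _).
have [||w0 w0C bw0] := IHk _ (lt false) (loH false) (nh false) (lower x z + w).
- apply: supportedD; first exact: supported_lower.
  exact: supported_sub (reduction_sub C x) wR.
- by rewrite bdD bw addchainF2.
have [||w1 w1C bw1] := IHk _ (lt true) (loH true) (nh true)
  (z + bd (prism x w) + (lower x z + w)).
- exact: supported_upper.
- by rewrite !bdD bz bdK bw !addchainF2.
exists (prism x w + w0 + w1).
  apply: supportedD; last exact: supported_sub (halfspace_sub _ _ _) w1C.
  apply: supportedD; last exact: supported_sub (halfspace_sub _ _ _) w0C.
  exact: supported_prism wR.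
(* Both copies of [a] and of [b] cancel modulo two, leaving [z]. *)
rewrite !bdD bw0 bw1; set a := lower x z + w; set b := bd (prism x w).
by rewrite -[z + b + a]addrA [LHS]addrCA addchainF2 addr0.
Qed.

End Cubes.

(** * The cubical boundary as a matrix *)

Section Incidence.
Local Open Scope ring_scope.
Variable n : nat.
Notation m := #|{: cell n}|.

Definition basis_chain (s : cell n) : chain n := [ffun s' => (s' == s)%:R].
Definition chain_col (z : chain n) : 'cV['F_2]_m := \col_i z (enum_val i).
Definition col_chain (z : 'cV['F_2]_m) : chain n := [ffun s => z (enum_rank s) 0].
Definition incidence : 'M['F_2]_m :=
  \matrix_(i, j) bd (basis_chain (enum_val j)) (enum_val i).

Lemma col_chainK z : chain_col (col_chain z) = z.
Proof. by apply/matrixP=> i j; rewrite ord1 mxE ffunE enum_valK. Qed.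

Lemma incidence_mul z : incidence *m chain_col z = chain_col (bd z).
Proof.
have sum_basis (f : cell n) : \sum_s basis_chain s f * z s = z f.
  rewrite (bigD1 f) //= big1 ?ffunE ?eqxx ?mul1r ?addr0 // => s sf.
  by rewrite ffunE eq_sym (negbTE sf) mul0r.
apply/matrixP=> i j; rewrite ord1 !mxE {j}.
under eq_bigr do rewrite !mxE.
rewrite -(reindex enum_val (P := predT)
  (F := fun s => bd (basis_chain s) (enum_val i) * z s)) /=;
  last by apply: onW_bij; apply: enum_val_bij.
rewrite [RHS]ffunE; case: (enum_val i) => [t|]; under eq_bigr do rewrite ffunE mulr_suml.
  by rewrite exchange_big /=; apply: eq_bigr => x _; apply: sum_basis.
by rewrite exchange_big /=; apply: eq_bigr => x _; apply: sum_basis.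
Qed.

Lemma incidence_sqr : incidence *m incidence = 0.
Proof.
apply/matrixP=> i j; rewrite [RHS]mxE.
have -> : (incidence *m incidence) i j =
    (incidence *m chain_col (bd (basis_chain (enum_val j)))) i 0.
  by rewrite !mxE; apply: eq_bigr => k _; rewrite !mxE.
by rewrite incidence_mul bdK !mxE ffunE.
Qed.

Lemma incidence_facet i j : incidence i j != 0 -> facet (enum_val i) (enum_val j).
Proof.
rewrite mxE => /bd_neq0[s fs]; rewrite ffunE; case: (s =P _) => [<- //|_ /eqP//].
Qed.

End Incidence.

(** * The Radon number of extremal classes *)

Section ExtremalRadon.
Local Open Scope ring_scope.
Variables (n : nat) (C : {set concept n}).

(** A convex set containing [Q] is cut out of [C] by half-spaces that contain [Q], and each of these
    contains [e]. *)
Lemma mem_conv (Q : {set concept n}) e : e \in C ->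
  (forall x b, (forall p, p \in Q -> p x = b) -> e x = b) -> e \in conv C Q.
Proof.
move=> eC eQ; apply/bigcapP=> K /andP[/existsP[Hs /andP[/subsetP sH /eqP ->]] sQK].
rewrite inE eC; apply/bigcapP=> h hH; have /imsetP[[x b] _ hE] := sH h hH.
rewrite hE inE eC; apply/eqP/eQ => p /(subsetP sQK).
rewrite inE => /andP[_ /bigcapP/(_ h hH)].
by rewrite hE inE => /andP[_ /eqP].
Qed.

Lemma radon_independent_conv (P I : {set concept n}) :
  radon_independent C P -> I \subset P -> I != set0 -> P :\: I != set0 ->
  conv C I :&: conv C (P :\: I) = set0.
Proof.
move=> /forallP/(_ I)/forallP/(_ (P :\: I))/implyP indP sIP nI nJ; apply/eqP/indP.
rewrite nI nJ /= setIDA setIC -setIDA setDv setI0 eqxx; apply/eqP/setP=> c.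
by rewrite !inE; have := subsetP sIP c; case: (c \in I) => //= ->.
Qed.

(** Apply the obstruction to [2 vc + 2] points of a supposedly larger independent set, carried by
    the cubes inside their hulls. *)
Lemma extremal_radon_vc : extremal C -> (radon C <= (vc C).*2.+1)%N.
Proof.
move=> exC; apply/bigmax_leqP=> P /andP[/subsetP sPC indP]; rewrite leqNgt.
apply/negP=> ltP; pose N := (vc C).*2.+2.
have [c0 _] : exists c0, c0 \in P by apply/card_gt0P; case: (#|P|) ltP.
pose pt (i : 'I_N) := nth c0 (enum P) i.
have ptlt (i : 'I_N) : (i < size (enum P))%N.
  by rewrite -cardE; apply: leq_trans ltP.
have ptP i : pt i \in P by rewrite -mem_enum mem_nth.
have pt_inj : injective pt.
  move=> i j /eqP; rewrite nth_uniq ?enum_uniq ?ptlt // => /eqP.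
  exact: val_inj.
(* Cutting by the conditions shared by the chosen points presents their hull as a [cut], the form
   that inherits lopsidedness. *)
pose common (I : {set 'I_N}) :=
  [seq xb <- enum {: 'I_n * bool} | [forall i in I, pt i xb.1 == xb.2]].
have common_sub (I J : {set 'I_N}) : I \subset J -> {subset common J <= common I}.
  move=> /subsetP sIJ xb; rewrite !mem_filter => /andP[/forall_inP h ->].
  by rewrite andbT; apply/forall_inP=> i /sIJ/h.
(* Radon independence concerns two nonempty parts; with [set0] for no points, only the empty face
   lies in that hull. *)
pose hull I := if I == set0 then set0 else cut C (common I).
have hull_sub I : hull I \subset C.
  by rewrite /hull; case: eqP => _; rewrite ?sub0set //; apply/subsetP=> c /setIdP[].
have hull_mono (I J : {set 'I_N}) : I \subset J -> hull I \subset hull J.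
  move=> sIJ; rewrite /hull; have [_|nI] := eqVneq I set0; first exact: sub0set.
  have [J0|_] := eqVneq J set0; first by rewrite J0 subset0 (negbTE nI) in sIJ.
  apply/subsetP=> c /setIdP[cC /allP cI]; rewrite inE cC /=.
  by apply/allP=> xb /(common_sub _ _ sIJ)/cI.
have hull_conv (I : {set 'I_N}) (Q : {set concept n}) e :
    (forall i, i \in I -> pt i \in Q) -> e \in hull I -> e \in conv C Q.
  rewrite /hull => IQ; have [_|_] := eqVneq I set0; first by rewrite inE.
  case/setIdP=> eC /allP eI; apply: mem_conv => // x b Qx.
  apply/eqP; apply: (eI (x, b)); rewrite mem_filter mem_enum andbT.
  by apply/forall_inP=> i /IQ/Qx/= ->.
have hull_disj (I J : {set 'I_N}) e : [disjoint I & J] -> e \in hull I -> e \notin hull J.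
  move=> dIJ eI; apply/negP=> eJ.
  have [i iI] : exists i, i \in I.
    by apply/set0Pn; apply: contraTneq eI => ->; rewrite /hull eqxx inE.
  have [j jJ] : exists j, j \in J.
    by apply/set0Pn; apply: contraTneq eJ => ->; rewrite /hull eqxx inE.
  have ptJ k : k \in J -> pt k \in P :\: pt @: I.
    move=> kJ; rewrite inE ptP andbT mem_imset //.
    by apply: contraL kJ => kI; rewrite (disjointFr dIJ).
  have ptI k : k \in I -> pt k \in pt @: I by move=> kI; rewrite imset_f.
  have : e \in conv C (pt @: I) :&: conv C (P :\: pt @: I).
    by rewrite inE (hull_conv I) ?(hull_conv J).
  rewrite radon_independent_conv ?inE //.
  - by apply/subsetP=> _ /imsetP[k _ ->].
  - by apply/set0Pn; exists (pt i); apply: ptI.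
  - by apply/set0Pn; exists (pt j); apply: ptJ.
pose X (I : {set 'I_N}) (i : 'I_#|{: cell n}|) := inside (hull I) (enum_val i).
suff : #|'I_N| <> (vc C).*2.+2 by apply; rewrite card_ord.
apply: (@radon_obstruction _ (incidence n) (fun i : 'I_#|{: cell n}| => cell_dim (enum_val i))
  (enum_rank None) 'I_N X (vc C)).
- exact: incidence_sqr.
- by move=> i j /incidence_facet/cell_dim_facet.
- by rewrite enum_rankK.
- by move=> I; rewrite /X enum_rankK.
- by move=> I i j /incidence_facet; apply: inside_facet.
- by move=> I J i /hull_mono; apply: inside_sub.
- move=> I J i dIJ; rewrite /X -[i in i = _]enum_valK; case: (enum_val i) => [t|] //= inI inJ.
  have fits_t := @fits_odflt _ t [ffun => false].
  by have := hull_disj _ _ _ dIJ (inI _ fits_t); rewrite (inJ _ fits_t).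
- by move=> I i /(inside_sub (hull_sub I))/cell_dim_inside.
move=> I z nI zI Bz.
have hullE : hull I = cut C (common I) by rewrite /hull (negbTE nI).
have lo : lopsided (hull I) by rewrite hullE; apply/lopsided_cut/extremal_lopsided.
have n0 : hull I != set0.
  rewrite hullE; have /set0Pn[i iI] := nI; apply/set0Pn; exists (pt i).
  rewrite inE sPC ?ptP //; apply/allP=> xb; rewrite mem_filter => /andP[/forall_inP h _].
  exact: h.
have [||w wI bw] := lopsided_acyclic lo n0 (z := col_chain z).
- by move=> s; rewrite ffunE => /zI; rewrite /X enum_rankK.
- apply/ffunP=> s; have := incidence_mul (col_chain z); rewrite col_chainK Bz.
  by move/matrixP/(_ (enum_rank s) 0); rewrite [LHS]mxE [RHS]mxE enum_rankK => <-;
    rewrite ffunE.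
exists (chain_col w); first by move=> i; rewrite mxE => /wI.
by rewrite incidence_mul bw col_chainK.
Qed.

Lemma extremal_radon_dual_vc : extremal C -> (radon C <= 2 ^ (dual_vc C + 2) - 1)%N.
Proof.
move=> /extremal_radon_vc; have := vc_lt_dual_vc C.
by rewrite addn2 [(2 ^ _.+2)%N]expnS; move: (2 ^ _)%N => e; lia.
Qed.

End ExtremalRadon.

Theorem theoremD (R : realType) :
  (forall (n : nat) (C : {set concept n}), dual_vc C <= radon C) /\
  (~ exists F : nat -> nat -> nat,
       forall (n : nat) (C : {set concept n}),
         radon C <= F (vc C) (dual_vc C)) /\
  (forall (n : nat) (C : {set concept n}),
     extremal C -> radon C <= 2 ^ (dual_vc C + 2) - 1) /\
  (exists alpha : R, (0 < alpha)%R /\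
     forall m : nat, exists (n : nat) (C : {set concept n}),
       extremal C /\ m <= dual_vc C /\
       (alpha * 2%:R ^+ (dual_vc C + 2) <= (radon C)%:R)%R).
Proof.
split; first by move=> n C; apply: dual_vc_radon.
split.
  (* Both dimensions of every class [indicators] are at most one, so [b] bounds all the values of
     [F] attained there. *)
  case=> F radonF; pose b := F 0 0 + F 0 1 + F 1 0 + F 1 1.
  have Fb p q : p <= 1 -> q <= 1 -> F p q <= b.
    by case: p q => [|[|p]] [|[|q]] //; rewrite /b; lia.
  have := leq_trans (leq_radon_indicators b.+1) (radonF _ (indicators b.+1)).
  by rewrite ltnNge Fb ?vc_indicators ?dual_vc_indicators.
split; first by move=> n C; apply: extremal_radon_dual_vc.
(* The factor one quarter cancels the extra [2 ^ 2], leaving [2 ^ dual_vc <= n <= radon]. *)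
exists (4%:R^-1)%R; split; first by rewrite invr_gt0 ltr0n.
move=> m; exists (2 ^ m.+1), (nonzero _).
have n_gt0 : 0 < 2 ^ m.+1 by rewrite expn_gt0.
split; first exact: extremal_nonzero.
split; first exact: leq_dual_vc_nonzero.
rewrite exprD mulrCA -!natrX mulVf ?pnatr_eq0 // mulr1 ler_nat.
exact: leq_trans (exp_dual_vc _ n_gt0) (leq_radon_nonzero n_gt0).
Qed.
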